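(* Let $S_U$ be a Schubert union in $G(2,m)$ over $F_q$ which is the proper union of $s\ge1$ Schubert cycles $S_i$ with Krull dimensions $\delta_i$, $i=1,\dots,s$. Then the minimum distance of the code $C_U$ is $q^{\delta}$, where $\delta$ is the smallest number among the $\delta_i$.
   Context: Let $V$ be an $m$-dimensional vector space over $F_q$ with basis $e_1,\dots,e_m$ and $A_i=\mathrm{Span}(e_1,\dots,e_i)$. $G(2,m)$ is the Grassmann variety of $2$-dimensional subspaces of $V$ in its Plücker embedding in $\mathbf P^{k-1}$, $k=\binom m2$. For $1\le a<b\le m$ the Schubert cycle is $S_{(a,b)}=\{W\in G(2,m):\dim(W\cap A_a)\ge1,\ W\subset A_b\}$, of Krull dimension $a+b-3$. A Schubert union $S_U$ is a finite union of Schubert cycles with respect to this fixed flag; it is a proper union of $s$ Schubert cycles if it is a union of $s$ Schubert cycles but not a union of $s-1$ Schubert cycles. Let $K$ be the dimension of the linear span of the affine cone over $S_U$, and $g_U(q)$ the number of $F_q$-rational points of $S_U$. The code $C_U$ is the linear code over $F_q$ (up to equivalence) of length $g_U(q)$ and dimension $K$ with generator matrix the $K\times g_U(q)$ matrix whose columns are coordinate representatives of the $F_q$-points of $S_U$, obtained from their Plücker coordinates by deleting the $k-K$ Plücker coordinates that vanish identically on $S_U$. *)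

(* Defs.v *)
From HB Require Import structures.
From mathcomp Require Import all_boot all_order all_algebra.

Set Implicit Arguments.
Unset Strict Implicit.
Unset Printing Implicit Defensive.

Import Order.TTheory GRing.Theory Num.Theory.
Local Open Scope ring_scope.

(* Over a finite field the subspaces of V form a finite type; Schubert cycles
   are then finite sets of subspaces, i.e. of F-rational points of G(2, m). *)
Import VectorInternalTheory.

HB.instance Definition _ (F : finFieldType) (V : vectType F) :=
  [Countable of {vspace V} by <:].
HB.instance Definition _ (F : finFieldType) (V : vectType F) :=
  [Finite of {vspace V} by <:].

Section Schubert.

Variables (F : finFieldType) (V : vectType F) (m : nat) (e : m.-tuple V).

Definition flag (i : nat) : {vspace V} := <<take i e>>%VS.

Definition grassmannian2 : {set {vspace V}} := [set W | \dim W == 2].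

(* Pairs (a, b) are 1-based, as are the basis vectors spanning the flag. *)
Definition schubert_index (ab : nat * nat) : bool :=
  [&& 1 <= ab.1, ab.1 < ab.2 & ab.2 <= m]%N.

Definition schubert_cycle (ab : nat * nat) : {set {vspace V}} :=
  [set W in grassmannian2 |
     (1 <= \dim (W :&: flag ab.1))%N && (W <= flag ab.2)%VS].

(* The Krull dimension of S_(a,b), as given by its dimension formula; a + b >= 3
   for a schubert_index, so the subtraction is not truncated. *)
Definition krull_dim (ab : nat * nat) : nat := (ab.1 + ab.2 - 3)%N.

Definition is_schubert_union (s : nat) (ab : 'I_s -> nat * nat)
    (SU : {set {vspace V}}) : Prop :=
  (forall i, schubert_index (ab i)) /\ SU = \bigcup_i schubert_cycle (ab i).

Definition is_proper_schubert_union (s : nat) (ab : 'I_s -> nat * nat)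
    (SU : {set {vspace V}}) : Prop :=
  is_schubert_union ab SU
  /\ ~ (exists cd : 'I_s.-1 -> nat * nat, is_schubert_union cd SU).

Definition pluecker_index : finType := {ij : 'I_m * 'I_m | (ij.1 < ij.2)%N}.

(* The 2 x 2 minors of the coordinates of one chosen basis of W: Pluecker
   coordinates of W when \dim W = 2, any others being scalar multiples. *)
Definition pluecker (W : {vspace V}) : {ffun pluecker_index -> F^o} :=
  [ffun ij : pluecker_index =>
     let: (i, j) := val ij in
     let u := (vbasis W)`_0 in let v := (vbasis W)`_1 in
     coord e i u * coord e j v - coord e j u * coord e i v].

Definition affine_cone (SU : {set {vspace V}}) :
    seq {ffun pluecker_index -> F^o} :=
  [seq c *: pluecker W | c <- enum F, W <- enum SU].

Definition cone_span_dim (SU : {set {vspace V}}) : nat :=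
  \dim <<affine_cone SU>>%VS.

Definition nonvanishing (SU : {set {vspace V}}) : {set pluecker_index} :=
  [set ij | [exists W in SU, pluecker W ij != 0]].

(* row lists the Pluecker coordinates that are kept, pt lists the points, and
   c chooses a coordinate representative of each point.  All choices are
   allowed, as C_U is only defined up to equivalence.  For a Schubert union
   exactly cone_span_dim SU coordinates are kept, because S_U contains
   Span(e_i, e_j) whenever the coordinate (i, j) does not vanish on S_U. *)
Definition is_generator_matrix (SU : {set {vspace V}})
    (G : 'M[F]_(cone_span_dim SU, #|SU|)) : Prop :=
  exists (row : 'I_(cone_span_dim SU) -> pluecker_index)
         (pt : 'I_#|SU| -> {vspace V}) (c : 'I_#|SU| -> F),
    [/\ injective row /\ (forall ij, ij \in nonvanishing SU <->
                                     exists i, row i = ij),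
        injective pt /\ (forall W, W \in SU <-> exists j, pt j = W),
        forall j, c j != 0 &
        forall i j, G i j = c j * pluecker (pt j) (row i)].

End Schubert.

Definition linear_code (F : finFieldType) (K n : nat) (G : 'M[F]_(K, n)) :
    {set 'rV[F]_n} :=
  [set x | (x <= G)%MS].

Definition hamming_dist (F : finFieldType) (n : nat) (x y : 'rV[F]_n) : nat :=
  #|[set j | x 0 j != y 0 j]|.

Definition is_min_distance (F : finFieldType) (n : nat) (C : {set 'rV[F]_n})
    (d : nat) : Prop :=
  (exists x y, [/\ x \in C, y \in C, x != y & hamming_dist x y = d])
  /\ (forall x y, x \in C -> y \in C -> x != y -> (d <= hamming_dist x y)%N).

(* Main.v *)
Require Import Defs.
From HB Require Import structures.
From mathcomp Require Import all_boot all_order all_algebra all_field zify ring.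

Set Implicit Arguments.
Unset Strict Implicit.
Unset Printing Implicit Defensive.

Import GRing.Theory.

(** A word of the code is, up to nonzero factors, the list of values taken by a
    linear combination of Pluecker coordinates at the points of the Schubert
    union, that is, by an alternating form B on V evaluated on a basis of each
    plane W.  Its weight is the number of planes of the union on which B does
    not vanish.

    Lower bound.  A nonzero word is nonzero at a plane of some cycle
    S_(a,b) of the union, so it is enough to find q^(a+b-3) such planes in that
    one cycle.  Let A < A' be the subspaces of dimensions a < b of the flag
    and count the pairs (x, y) in A x A' with B x y <> 0.  On the one hand x
    must avoid the radical R = {x in A | B x = 0 on A'}, and then y avoids a
    hyperplane of A'.  On the other hand every such pair spans a plane to be
    counted, and this plane arises from q (q-1)^2 pairs if it meets A in a line
    and from q + 1 times as many if it lies in A [planes_equation].  If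
    B = 0 on A, planes of the second kind do not occur and R <> A is enough.
    Otherwise A carries two vectors with B x1 y1 <> 0, so R has codimension at
    least 2 in A, and this larger supply of pairs compensates exactly for the
    planes inside A, which are few because a < b [card_planes_ge].

    The bound is attained.  Let S_(a,b) be a cycle of smallest dimension and
    take the single coordinate p_(a,b).  It vanishes on S_(c,d) unless a <= c
    and b <= d, and since the union is proper no other of its cycles satisfies
    this.  On S_(a,b) itself the form p_(a,b) is zero on A, and the double
    count is the equality q^(a+b-3) [schubert_cycle_corner_count]. *)

(** * Arithmetic of the count *)

(** The count when the form is nonzero on the smaller space A: with
    dim A = a + 2 and dim A' = b + 2, the numbers X and X2 stand for the
    vectors of A outside the radical relative to A' and to A, and g and g2 for
    the planes counted in A' and in A.  Eliminating g2 leaves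
    (q^2 - 1) g = (q + 1) X q^b - q X2 q^a >= q X q^b, because q^(a+1) <= q^b,
    and the lower bound on X has the factor q^2 - 1. *)
Lemma leq_expn_count (q a b X X2 g g2 : nat) : (1 < q)%N ->
  (X * q ^ b.+1 = q * (q.-1 * (g + q * g2)))%N ->
  (X2 * q ^ a.+1 = q * (q.-1 * (g2 + q * g2)))%N ->
  (X2 <= X)%N -> (q.-1 * q ^ a.+1 + q.-1 * q ^ a <= X)%N -> (a < b)%N ->
  (q ^ (a + b.+1) <= g)%N.
Proof.
move=> q1; rewrite expnD !(expnS q a) !(expnS q b) => E1 E2 leX lbX ltab.
have leab : (q * q ^ a <= q ^ b)%N by rewrite -expnS leq_exp2l.
have q0 : (0 < q)%N by lia.
have {}E1 : (X * q ^ b = q.-1 * (g + q * g2))%N.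
  by apply/eqP; rewrite -(eqn_pmul2l q0) -E1 mulnCA.
have {}E2 : (X2 * q ^ a = q.-1 * (g2 + q * g2))%N.
  by apply/eqP; rewrite -(eqn_pmul2l q0) -E2 mulnCA.
have Eg : ((q.-1 * q.+1) * g + q * (X2 * q ^ a) = q.+1 * (X * q ^ b))%N.
  by rewrite E1 E2; nia.
have leX2 : (q * (X2 * q ^ a) <= X * q ^ b)%N.
  by rewrite mulnCA leq_mul.
have lbXb : ((q.-1 * q.+1) * q ^ a * q ^ b <= X * q ^ b)%N.
  rewrite leq_mul2r; apply/orP; right; apply: leq_trans lbX; nia.
have P0 : (0 < q.-1 * q.+1)%N by lia.
rewrite -(leq_pmul2l P0).
have : (q * (X * q ^ b) <= q.-1 * q.+1 * g)%N by nia.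
apply: leq_trans.
have -> : (q.-1 * q.+1 * (q ^ a * (q * q ^ b)) =
           q * (q.-1 * q.+1 * q ^ a * q ^ b))%N by nia.
by rewrite leq_mul2l lbXb orbT.
Qed.

Lemma pred_mul_expnD (q a b : nat) : (1 < q)%N ->
  (q.-1 * q ^ a * q ^ b.+1 = q * (q.-1 * q ^ (a + b)))%N.
Proof. by move=> q1; rewrite expnS expnD; nia. Qed.

(** * Planes on which an alternating form does not vanish *)

Section Counting.

Local Open Scope ring_scope.

Variables (F : finFieldType) (V : vectType F).
Local Notation q := #|F|.
Local Notation fV := (finvect_type V).

(* A vector space over a finite field gets its finite type structure through
   the alias finvect_type; the casts to V below keep membership in V. *)
Lemma card_mem_vspace (U : {vspace V}) :
  #|[set x : fV | (x : V) \in U]| = (q ^ \dim U)%N.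
Proof.
rewrite cardsE; case: V U => T c U.
by rewrite -(@card_vspace F (finvect_type (Vector.Pack c)) c U); apply: eq_card.
Qed.

Lemma dim_cap_lker (f : {linear V -> F^o}) (U : {vspace V}) u :
  u \in U -> f u != 0 -> (\dim (U :&: lker (linfun f))).+1 = \dim U.
Proof.
move=> uU fu0; rewrite -(limg_ker_dim (linfun f) U) -addn1; congr addn.
apply/eqP; rewrite eqn_leq; apply/andP; split.
  rewrite lt0n dimv_eq0; apply: contra fu0 => /eqP f0.
  by rewrite -memv0 -f0 -(lfunE f) memv_img.
by rewrite -[leqRHS](dimvf (F^o)) dimvS ?subvf.
Qed.

Lemma card_nonzeros (f : {linear V -> F^o}) (U : {vspace V}) u :
  u \in U -> f u != 0 ->
  #|[set x : fV | ((x : V) \in U) && (f x != 0)]| = (q.-1 * q ^ (\dim U).-1)%N.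
Proof.
move=> uU fu0; have dU := dim_cap_lker uU fu0.
have -> : [set x : fV | ((x : V) \in U) && (f x != 0)] =
    [set x : fV | (x : V) \in U] :\:
    [set x : fV | (x : V) \in U :&: lker (linfun f)]%VS.
  apply/setP=> x; rewrite !inE memv_cap memv_ker lfunE.
  by case: (_ \in U); rewrite ?andbT ?andbF.
rewrite cardsD (setIidPr _) ?card_mem_vspace -?dU /=; last first.
  by apply/subsetP=> x; rewrite !inE memv_cap => /andP[].
by rewrite expnS -subn1 mulnBl mul1n.
Qed.

Variable B : V -> {linear V -> F^o}.
Hypothesis B_alt : forall x, B x x = 0.
(** Antisymmetry is what gives linearity in the first argument; it does not
    follow from B_alt, as B is assumed linear in its second argument only. *)
Hypothesis B_anti : forall x y, B x y = - B y x.

Lemma form_linearl a b x y z :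
  B (a *: x + b *: y) z = a *: B x z + b *: B y z.
Proof.
rewrite B_anti linearD !linearZ /= opprD -!scalerN.
by rewrite -(B_anti x) -(B_anti y).
Qed.

(** The form changes by a determinant under a change of basis of a plane, so
    that its vanishing on a plane can be tested on any basis. *)
Lemma form_comb a b c d x y :
  B (a *: x + b *: y) (c *: x + d *: y) = (a * d - b * c) *: B x y.
Proof.
rewrite form_linearl !linearD !linearZ /= !B_alt (B_anti y x) !scaler0.
by rewrite add0r addr0 !scalerN !scalerA -scalerBl [d * a]mulrC [c * b]mulrC.
Qed.

Lemma form_neq0_sym x y : (B x y != 0) = (B y x != 0).
Proof. by rewrite B_anti oppr_eq0. Qed.

Definition nonzero_on (W : {vspace V}) := B (vbasis W)`_0 (vbasis W)`_1 != 0.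

Lemma plane_vbasis (W : {vspace V}) : \dim W = 2%N ->
  W = (<[(vbasis W)`_0]> + <[(vbasis W)`_1]>)%VS.
Proof.
move=> dW; rewrite -{1}(span_basis (vbasisP W)).
have sW : size (vbasis W) = 2%N by rewrite size_tuple.
case E: (tval (vbasis W)) sW => [|x [|y []]] //= _.
by rewrite span_cons span_seq1.
Qed.

Lemma dim_span_form x y : B x y != 0 -> \dim (<[x]> + <[y]>) = 2%N.
Proof.
move=> Bxy; have x0 : x != 0.
  by apply: contraNneq Bxy => ->; rewrite B_anti linear0 oppr0.
have y0 : y != 0 by apply: contraNneq Bxy => ->; rewrite linear0.
rewrite dimv_disjoint_sum ?dim_vline ?x0 ?y0 //.
apply/eqP; rewrite -subv0; apply/subvP=> z /memv_capP[/vlineP[k ->]].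
case/vlineP=> l kl; rewrite memv0; have := congr1 (B x) kl.
rewrite !linearZ /= B_alt scaler0 => /esym/eqP.
rewrite scaler_eq0 (negPf Bxy) orbF => /eqP l0.
by rewrite kl l0 scale0r.
Qed.

Lemma plane_span (W : {vspace V}) x y : \dim W = 2%N -> x \in W -> y \in W ->
  B x y != 0 -> W = (<[x]> + <[y]>)%VS.
Proof.
move=> dW xW yW Bxy; apply/esym/eqP; rewrite eqEdim dW dim_span_form // andbT.
by rewrite subv_add -!memvE xW.
Qed.

Lemma memv_span2l x y : x \in (<[x]> + <[y]> : {vspace V})%VS.
Proof. by rewrite (subvP (addvSl _ _)) // memv_line. Qed.

Lemma memv_span2r x y : y \in (<[x]> + <[y]> : {vspace V})%VS.
Proof. by rewrite (subvP (addvSr _ _)) // memv_line. Qed.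

Lemma form_span_neq0 x y u v :
  u \in (<[x]> + <[y]>)%VS -> v \in (<[x]> + <[y]>)%VS ->
  B u v != 0 -> B x y != 0.
Proof.
case/memv_addP=> _ /vlineP[a ->] [_ /vlineP[b ->] ->].
case/memv_addP=> _ /vlineP[c ->] [_ /vlineP[d ->] ->].
by rewrite form_comb scaler_eq0 negb_or => /andP[].
Qed.

Lemma nonzero_onP (W : {vspace V}) x y : \dim W = 2%N -> x \in W -> y \in W ->
  B x y != 0 -> nonzero_on W.
Proof.
by move=> dW xW yW; apply: form_span_neq0; rewrite -plane_vbasis.
Qed.

(** The points of the Schubert cycle attached to A and A' where B is nonzero. *)
Definition nonzero_planes (A A' : {vspace V}) : {set {vspace V}} :=
  [set W | [&& \dim W == 2%N, (W :&: A != 0)%VS, (W <= A')%VS & nonzero_on W]].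

Definition nonzero_pairs (A A' : {vspace V}) : {set fV * fV} :=
  [set p : fV * fV | [&& (p.1 : V) \in A, (p.2 : V) \in A' & B p.1 p.2 != 0]].

Definition nonradical (A A' : {vspace V}) : {set fV} :=
  [set x : fV | ((x : V) \in A) &&
     [exists y : fV, ((y : V) \in A') && (B x y != 0)]].

Lemma nonradicalP (A A' : {vspace V}) (x : fV) :
  reflect (exists y : V, [/\ (x : V) \in A, y \in A' & B x y != 0])
          (x \in nonradical A A').
Proof.
rewrite inE; apply: (iffP andP) => [[xA /existsP[y /andP[yA' Bxy]]]|].
  by exists y.
by case=> y [xA yA' Bxy]; split=> //; apply/existsP; exists y; rewrite yA'.
Qed.

(** For a fixed x outside the radical, the admissible y are the vectors of A'
    off the hyperplane where B x vanishes. *)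
Lemma card_pairs (A A' : {vspace V}) :
  #|nonzero_pairs A A'| = (#|nonradical A A'| * (q.-1 * q ^ (\dim A').-1))%N.
Proof.
rewrite -sum1_card (eq_bigl (fun p : fV * fV => (p.1 \in nonradical A A') &&
  (((p.2 : V) \in A') && (B p.1 p.2 != 0)))); last first.
  case=> x y; rewrite inE /=; apply/and3P/andP => [[xA yA Bxy]|].
    by rewrite yA Bxy; split=> //; apply/nonradicalP; exists y.
  by rewrite inE => -[/andP[-> _] /andP[]].
rewrite -(pair_big_dep (mem (nonradical A A'))
   (fun x y : fV => ((y : V) \in A') && (B x y != 0)) (fun _ _ => 1%N)) /=.
rewrite -sum_nat_const; apply: eq_bigr => x /nonradicalP[y [xA yA' Bxy]].
rewrite -(card_nonzeros yA' Bxy) -sum1_card.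
by apply: eq_bigl => z; rewrite inE.
Qed.

(** A pair with B x y <> 0 lies in exactly one plane, its span, and there B is
    nonzero; the fibre over W consists of the pairs of W :&: A and W. *)
Lemma card_pairs_planes (A A' : {vspace V}) : (A <= A')%VS ->
  #|nonzero_pairs A A'| =
  (\sum_(W in nonzero_planes A A') #|nonzero_pairs (W :&: A) W|)%N.
Proof.
move=> /subvP sAA'; rewrite -sum1_card.
rewrite (partition_big (fun p : fV * fV => <[p.1 : V]> + <[p.2 : V]>)%VS
          (mem (nonzero_planes A A'))) /=; last first.
  case=> x y; rewrite inE /= => /and3P[xA yA' Bxy].
  rewrite inE (nonzero_onP _ (memv_span2l x y) (memv_span2r x y))
    ?dim_span_form //.
  rewrite subv_add -!memvE sAA' // yA' !andbT /=.
  apply/eqP=> W0; have: (x : V) \in 0%VS by rewrite -W0 memv_cap memv_span2l.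
  rewrite memv0 => /eqP x0; move: Bxy.
  by rewrite B_anti x0 linear0 oppr0 eqxx.
apply: eq_bigr => W; rewrite inE => /and4P[/eqP dW _ /subvP sWA' _].
rewrite -sum1_card; apply: eq_bigl => -[x y]; rewrite !inE /= memv_cap.
apply/andP/and3P => [[/and3P[xA yA' Bxy] /eqP <-]|[/andP[xW xA] yW Bxy]].
  by rewrite xA Bxy memv_span2l memv_span2r.
by rewrite xA sWA' // Bxy -(plane_span dW).
Qed.

(** B restricted to a plane where it is nonzero is nondegenerate. *)
Lemma card_nonradical_plane (D W : {vspace V}) : \dim W = 2%N -> nonzero_on W ->
  (D <= W)%VS -> #|nonradical D W| = (q ^ \dim D).-1.
Proof.
move=> dW nW /subvP sDW.
rewrite -card_mem_vspace (cardsD1 (0 : fV)) inE mem0v /=.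
apply: eq_card => x; rewrite [RHS]in_setD1; apply/nonradicalP/andP; last first.
  rewrite inE => -[x0 xD].
  have vW i : (i < 2)%N -> (vbasis W)`_i \in W.
    by move=> lti; rewrite vbasis_mem // mem_nth // size_tuple dW.
  move: (sDW _ xD); rewrite {1}(plane_vbasis dW).
  case/memv_addP=> _ /vlineP[a ->] [_ /vlineP[b ->] xE].
  have [a0 | a0] := eqVneq a 0; last first.
    exists (vbasis W)`_1; split; rewrite ?vW // xE form_linearl B_alt.
    by rewrite scaler0 addr0 scaler_eq0 negb_or a0.
  exists (vbasis W)`_0; split; rewrite ?vW // xE form_linearl B_alt.
  rewrite scaler0 add0r scaler_eq0 negb_or form_neq0_sym andbC.
  apply/andP; split=> //; apply: contraNneq x0 => b0.
  by rewrite xE a0 b0 !scale0r addr0.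
case=> y [xD _ Bxy]; rewrite inE; split=> //; apply/eqP=> x0.
by move: Bxy; rewrite x0 B_anti linear0 oppr0 eqxx.
Qed.

(** The double count of the pairs (x, y), freed from a common factor q - 1.  A
    plane W contributes q^d - 1 choices of x, with d = dim (W :&: A); as
    q^2 - 1 = (q - 1) (1 + q), a plane inside A has weight 1 + q instead of 1,
    which the last term accounts for. *)
Lemma planes_equation (A A' : {vspace V}) : (A <= A')%VS ->
  (#|nonradical A A'| * q ^ (\dim A').-1 =
   q * (q.-1 * (#|nonzero_planes A A'| + q * #|nonzero_planes A A|)))%N.
Proof.
move=> sAA'; have := card_pairs_planes sAA'.
have q1 : (1 < q)%N := card_finNzRing_gt1 F.
rewrite card_pairs.
have count_plane W : W \in nonzero_planes A A' ->
    #|nonzero_pairs (W :&: A) W| = (q.-1 * q * q.-1 * (1 + q * (W <= A)%VS))%N.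
  rewrite inE => /and4P[/eqP dW WA0 _ nW].
  rewrite card_pairs card_nonradical_plane ?capvSl // dW expn1.
  suff -> : (q ^ \dim (W :&: A)).-1 = (q.-1 * (1 + q * (W <= A)%VS))%N by lia.
  have [/capv_idPl -> | nWA] := boolP (W <= A)%VS; first by rewrite dW; nia.
  suff -> : \dim (W :&: A) = 1%N by rewrite expn1 muln0 muln1.
  apply/eqP; rewrite eqn_leq lt0n dimv_eq0 WA0 andbT -ltnS -dW.
  rewrite ltn_neqAle dimvS ?capvSl // (dimv_leqif_eq (capvSl W A)).2 andbT.
  by apply: contra nWA => /eqP/capv_idPl.
rewrite (eq_bigr _ count_plane) -big_distrr big_split /= sum1_card.
rewrite -big_distrr /=.
have -> : (\sum_(W in nonzero_planes A A') (W <= A)%VS =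
           #|nonzero_planes A A|)%N.
  rewrite -sum1_card (bigID (fun W => (W <= A)%VS)) /= [X in (_ + X)%N]big1.
    rewrite addn0; apply: eq_big => [W|W /andP[_ ->]] //.
    rewrite !inE; case sWA: (W <= A)%VS; rewrite ?andbF // (subv_trans sWA) //.
    by rewrite andbT.
  by move=> W /andP[_ /negPf ->].
move=> E; apply/eqP; rewrite -(@eqn_pmul2l q.-1); last by lia.
by rewrite mulnCA E -!mulnA.
Qed.

Lemma planes_isotropic (A : {vspace V}) :
  (forall x y, x \in A -> y \in A -> B x y = 0) -> nonzero_planes A A = set0.
Proof.
move=> isoA; apply/setP=> W; rewrite !inE; apply/negP=> /and4P[/eqP dW _].
move=> /subvP sWA; rewrite /nonzero_on isoA ?eqxx // sWA //.
  by rewrite vbasis_mem // mem_nth // size_tuple dW.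
by rewrite vbasis_mem // mem_nth // size_tuple dW.
Qed.

Lemma dim_form_gt1 (U : {vspace V}) x y :
  x \in U -> y \in U -> B x y != 0 -> (1 < \dim U)%N.
Proof.
by move=> xU yU /dim_span_form <-; rewrite dimvS // subv_add -!memvE xU.
Qed.

(** How radicals are bounded: each y0 in A' puts the vectors of A off the
    hyperplane B y0 = 0 outside the radical. *)
Lemma nonzeros_sub_nonradical (A A' : {vspace V}) y0 : y0 \in A' ->
  [set x : fV | ((x : V) \in A) && (B y0 x != 0)] \subset nonradical A A'.
Proof.
move=> yA'; apply/subsetP=> x; rewrite inE => /andP[xA Byx].
by apply/nonradicalP; exists y0; rewrite form_neq0_sym.
Qed.

(** The last hypothesis says that the radical is no smaller than the hyperplane
    of A cut out by y0, so the double count has exactly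
    (q - 1) q^(dim A - 1) choices of x. *)
Lemma card_planes_isotropic (A A' : {vspace V}) x0 y0 : (A <= A')%VS ->
  (forall x y, x \in A -> y \in A -> B x y = 0) ->
  x0 \in A -> y0 \in A' -> B x0 y0 != 0 ->
  (forall x y, x \in A -> y \in A' -> B x y0 = 0 -> B x y = 0) ->
  #|nonzero_planes A A'| = (q ^ (\dim A + \dim A' - 3))%N.
Proof.
move=> sAA' isoA x0A y0A' B00 By0; have := planes_equation sAA'.
rewrite planes_isotropic // cards0 muln0 addn0.
have -> : #|nonradical A A'| = (q.-1 * q ^ (\dim A).-1)%N.
  rewrite form_neq0_sym in B00; rewrite -(card_nonzeros x0A B00).
  apply: eq_card; apply/subset_eqP; rewrite nonzeros_sub_nonradical // andbT.
  apply/subsetP=> x /nonradicalP[y [xA yA' Bxy]]; rewrite inE xA form_neq0_sym.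
  by apply: contraNneq Bxy => /(By0 _ _ xA yA')->.
have : (1 < q)%N := card_finNzRing_gt1 F.
have := dim_form_gt1 (subvP sAA' _ x0A) y0A' B00.
case dA: (\dim A) => [|a]; last case: (\dim A') => [|[|b]] //= _ q1.
  move/eqP: dA B00; rewrite dimv_eq0 => /eqP A0.
  by move: x0A; rewrite A0 memv0 => /eqP->; rewrite B_anti linear0 oppr0 eqxx.
have -> : (a.+1 + b.+2 - 3 = a + b)%N by lia.
rewrite pred_mul_expnD // => /eqP.
by rewrite !eqn_pmul2l => [/eqP->||]; lia.
Qed.

(** If B = 0 on A, the double count only sees planes that meet A in a line.
    Otherwise the weight q + 1 of the planes inside A costs a factor, which is
    regained from the radical having codimension at least 2 in A. *)
Lemma card_planes_ge (A A' : {vspace V}) x0 y0 : (A <= A')%VS ->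
  (\dim A < \dim A')%N -> x0 \in A -> y0 \in A' -> B x0 y0 != 0 ->
  (q ^ (\dim A + \dim A' - 3) <= #|nonzero_planes A A'|)%N.
Proof.
move=> sAA' ltAA' x0A y0A' B00; have := planes_equation sAA'.
have := planes_equation (subvv A).
have q1 : (1 < q)%N := card_finNzRing_gt1 F.
have sact : (#|nonradical A A| <= #|nonradical A A'|)%N.
  apply/subset_leq_card/subsetP=> x /nonradicalP[y [xA yA Bxy]].
  by apply/nonradicalP; exists y; rewrite (subvP sAA').
have [[x1 [y1 [x1A y1A B11]]] | isoA] :
    (exists x1 y1, [/\ x1 \in A, y1 \in A & B x1 y1 != 0]) \/
    (forall x y, x \in A -> y \in A -> B x y = 0).
  have [/existsP[x1 /existsP[y1 /and3P[]]] | /existsPn isoA] :=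
    boolP [exists x : fV, exists y : fV,
             [&& (x : V) \in A, (y : V) \in A & B x y != 0]].
    by left; exists x1, y1.
  right=> x y xA yA; apply: contraNeq (isoA x) => Bxy.
  by apply/existsP; exists y; rewrite xA yA.
  (* The radical lies in the common kernel of B y1 and B x1, of codimension 2
     in A: count the vectors off the first kernel, then those in the first
     kernel but off the second, such as y1. *)
  have lbX : (q.-1 * q ^ (\dim A).-1 + q.-1 * q ^ (\dim A).-2 <=
              #|nonradical A A'|)%N.
    rewrite form_neq0_sym in B11; rewrite -(card_nonzeros x1A B11).
    have dK := dim_cap_lker x1A B11.
    have y1K : y1 \in (A :&: lker (linfun (B y1)))%VS.
      by rewrite memv_cap memv_ker lfunE /= B_alt eqxx andbT.
    rewrite form_neq0_sym in B11.
    rewrite -dK -(card_nonzeros y1K B11) -cardsUI.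
    rewrite (_ : _ :&: _ = set0) ?cards0 ?addn0; last first.
      apply/setP=> x; rewrite !inE memv_cap memv_ker lfunE /=.
      by case: (B y1 x == 0); rewrite ?andbF.
    apply/subset_leq_card/subUsetP; split.
      by apply: nonzeros_sub_nonradical; rewrite (subvP sAA').
    apply: subset_trans (nonzeros_sub_nonradical A (subvP sAA' _ x1A)).
    by apply/subsetP=> x; rewrite !inE memv_cap => /andP[/andP[->]].
  move: (dim_form_gt1 x1A y1A B11) ltAA' lbX sact.
  case: (\dim A) => [|[|a]] //= _; case: (\dim A') => [|[|b]] //= ltab.
  have -> : (a.+2 + b.+2 - 3 = a + b.+1)%N by lia.
  by move=> lbX leX E2 E1; apply: (leq_expn_count q1 E1 E2 leX lbX).
move=> _; rewrite planes_isotropic // cards0 muln0 addn0.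
have := subset_leq_card (nonzeros_sub_nonradical A y0A').
have := dim_form_gt1 (subvP sAA' _ x0A) y0A' B00.
rewrite form_neq0_sym in B00; rewrite (card_nonzeros x0A B00).
case dA: (\dim A) => [|a]; last case: (\dim A') => [|[|b]] //= _ lbX E.
  move/eqP: dA B00; rewrite dimv_eq0 => /eqP A0.
  by move: x0A; rewrite A0 memv0 => /eqP->; rewrite linear0 eqxx.
have -> : (a.+1 + b.+2 - 3 = a + b)%N by lia.
have := leq_mul lbX (leqnn (q ^ b.+1)).
rewrite pred_mul_expnD // E !leq_pmul2l ?(ltnW q1) //.
by rewrite -ltnS prednK ?(ltnW q1).
Qed.

Lemma planes_witness (A A' : {vspace V}) W :
  (A <= A')%VS -> W \in nonzero_planes A A' ->
  exists x y, [/\ x \in A, y \in A' & B x y != 0].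
Proof.
move=> sAA' Wpl; have pl_gt0 : (0 < #|nonzero_planes A A'|)%N.
  by apply/card_gt0P; exists W.
have q1 : (1 < q)%N := card_finNzRing_gt1 F.
have /card_gt0P[x /nonradicalP[y xy]] : (0 < #|nonradical A A'|)%N.
  have : (0 < #|nonradical A A'| * q ^ (\dim A').-1)%N.
    rewrite planes_equation // !muln_gt0 addn_gt0 pl_gt0 (ltnW q1) andbT.
    by rewrite -ltnS prednK // ltnW.
  by rewrite muln_gt0 => /andP[].
by exists x, y.
Qed.

End Counting.

(** * The flag and its Schubert cycles *)

Section Flag.

Local Open Scope ring_scope.

Variables (F : finFieldType) (V : vectType F) (m : nat) (e : m.-tuple V).

Lemma flagS a c : (a <= c)%N -> (flag e a <= flag e c)%VS.
Proof.
move=> leac; apply: sub_span => x; rewrite -(take_takel e leac).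
exact: mem_take.
Qed.

Lemma mem_flag a (i : 'I_m) : (i < a)%N -> e`_i \in flag e a.
Proof.
move=> ltia; rewrite memv_span // -(nth_take 0 ltia) mem_nth //.
by rewrite size_take_min size_tuple ltn_min ltia ltn_ord.
Qed.

Lemma schubert_cycleS ab cd : (ab.1 <= cd.1)%N -> (ab.2 <= cd.2)%N ->
  schubert_cycle e ab \subset schubert_cycle e cd.
Proof.
move=> le1 le2; apply/subsetP=> W; rewrite !inE => /andP[-> /andP[dW sW]] /=.
rewrite (subv_trans sW (flagS le2)) andbT (leq_trans dW) // dimvS //.
exact: capvS (subvv W) (flagS le1).
Qed.

Hypothesis e_free : free e.

Lemma dim_flag a : (a <= m)%N -> \dim (flag e a) = a.
Proof.
move=> leam; have : free (take a e ++ drop a e) by rewrite cat_take_drop.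
by move/catl_free/eqnP=> ->; rewrite size_takel ?size_tuple.
Qed.

Lemma coord_flag a (i : 'I_m) x :
  (a <= i)%N -> x \in flag e a -> coord e i x = 0.
Proof.
move=> leai xa; apply/eqP.
suff : x \in lker (linfun (coord e i : {linear V -> F^o})).
  by rewrite memv_ker lfunE.
apply: subvP xa; apply/span_subvP=> _ /(nthP 0)[k lt_k <-].
move: lt_k; rewrite size_take_min size_tuple ltn_min => /andP[ltka ltkm].
rewrite memv_ker lfunE /= nth_take // (coord_free (Ordinal ltkm)) //.
by rewrite -val_eqE /= ltn_eqF // (leq_trans ltka).
Qed.

End Flag.

(** * Linear combinations of Pluecker coordinates as alternating forms *)

Section PlueckerForm.

Local Open Scope ring_scope.

Variables (F : finFieldType) (V : vectType F) (m : nat) (e : m.-tuple V).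
Implicit Types (ij : pluecker_index m) (w : pluecker_index m -> F).

Definition minor x y ij : F :=
  coord e (val ij).1 x * coord e (val ij).2 y -
  coord e (val ij).2 x * coord e (val ij).1 y.

Definition pluecker_form w (x y : V) : F^o := \sum_ij w ij * minor x y ij.

Lemma pluecker_form_is_linear w x : linear (pluecker_form w x).
Proof.
move=> k y z; rewrite scaler_sumr -big_split; apply: eq_bigr => ij _ /=.
rewrite /minor !linearD !linearZ /= /GRing.scale /=; ring.
Qed.

HB.instance Definition _ w x :=
  GRing.isLinear.Build F V F^o _ (pluecker_form w x)
    (pluecker_form_is_linear w x).

Lemma plueckerE W ij : pluecker e W ij = minor (vbasis W)`_0 (vbasis W)`_1 ij.
Proof. by rewrite ffunE /minor; case: (val ij). Qed.

Lemma pluecker_form_alt w x : pluecker_form w x x = 0.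
Proof.
by rewrite /pluecker_form big1 // => ij _; rewrite /minor mulrBr; ring.
Qed.

Lemma pluecker_form_anti w x y : pluecker_form w x y = - pluecker_form w y x.
Proof.
rewrite /pluecker_form -sumrN; apply: eq_bigr => ij _; rewrite /minor; ring.
Qed.

Definition pluecker_functional w (W : {vspace V}) : F :=
  \sum_ij w ij * pluecker e W ij.

Lemma pluecker_form_vbasis w W :
  pluecker_form w (vbasis W)`_0 (vbasis W)`_1 = pluecker_functional w W.
Proof. by apply: eq_bigr => ij _; rewrite plueckerE. Qed.

Lemma sum_delta ij (g : pluecker_index m -> F) :
  \sum_kl (kl == ij)%:R * g kl = g ij.
Proof.
rewrite (bigD1 ij) //= eqxx mul1r big1 ?addr0 // => kl /negPf->.
by rewrite mul0r.
Qed.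

Lemma pluecker_form_delta ij x y :
  pluecker_form (fun kl => (kl == ij)%:R) x y = minor x y ij.
Proof. exact: sum_delta. Qed.

Hypothesis e_free : free e.

(** The coordinates of x vanish from a on and those of y from b on, so the minor
    is zero unless both of its indices are in range.  Since a < b and i < j, an
    index i >= a already makes both coordinates of x vanish. *)
Lemma minor_flag a b x y ij : (a < b)%N -> x \in flag e a -> y \in flag e b ->
  minor x y ij != 0 -> ((val ij).1 < a)%N && ((val ij).2 < b)%N.
Proof.
move=> ltab xa yb; have lt12 : ((val ij).1 < (val ij).2)%N := valP ij.
apply: contraNT; rewrite negb_and -!leqNgt => /orP[le1 | le2].
  rewrite /minor !(coord_flag e_free _ xa) ?mul0r ?subr0 //.
  by rewrite (leq_trans le1) // ltnW.
rewrite /minor [coord e (val ij).2 x](coord_flag e_free _ xa);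
  last exact: leq_trans (ltnW ltab) le2.
by rewrite [coord e (val ij).2 y](coord_flag e_free _ yb) // mulr0 mul0r subr0.
Qed.

Lemma schubert_cycle_planes w ab :
  [set W in schubert_cycle e ab | pluecker_functional w W != 0] =
  nonzero_planes (pluecker_form w) (flag e ab.1) (flag e ab.2).
Proof.
apply/setP=> W; rewrite !inE /nonzero_on /= pluecker_form_vbasis.
by rewrite lt0n dimv_eq0 !andbA.
Qed.

End PlueckerForm.

(** * Points of one Schubert cycle off a hyperplane *)

Section SchubertCount.

Local Open Scope ring_scope.

Variables (F : finFieldType) (V : vectType F) (m : nat) (e : m.-tuple V).
Hypothesis e_free : free e.

Lemma schubert_cycle_count_ge (w : pluecker_index m -> F) ab W :
  schubert_index m ab -> W \in schubert_cycle e ab ->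
  pluecker_functional e w W != 0 ->
  (#|F| ^ krull_dim ab <=
   #|[set W in schubert_cycle e ab | pluecker_functional e w W != 0%R]|)%N.
Proof.
case/and3P=> a1 ltab bm Wab wW; set S := [set _ in _ | _].
have : W \in S by rewrite inE Wab.
rewrite /S schubert_cycle_planes /krull_dim => Wpl.
have sAA' := flagS e (ltnW ltab).
have := card_planes_ge (pluecker_form_alt e w) (pluecker_form_anti e w) sAA'.
rewrite !dim_flag ?(leq_trans (ltnW ltab)) // => /(_ _ _ ltab) lb.
have [x0 [y0 [x0A y0A' B00]]] :=
  planes_witness (pluecker_form_alt e w) (pluecker_form_anti e w) sAA' Wpl.
exact: lb x0A y0A' B00.
Qed.

(** On the flag spaces the coordinate (a, b) is x_a * y_b, which vanishes for y
    in the smaller space and whose radical is the hyperplane x_a = 0. *)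
Lemma schubert_cycle_corner_count (ij : pluecker_index m) ab :
  schubert_index m ab -> (val ij).1.+1 = ab.1 -> (val ij).2.+1 = ab.2 ->
  #|[set W in schubert_cycle e ab | pluecker e W ij != 0]| =
  (#|F| ^ krull_dim ab)%N.
Proof.
case/and3P=> a1 ltab bm E1 E2.
pose w (kl : pluecker_index m) : F := (kl == ij)%:R.
have -> : [set W in schubert_cycle e ab | pluecker e W ij != 0] =
    nonzero_planes (pluecker_form e w) (flag e ab.1) (flag e ab.2).
  rewrite -schubert_cycle_planes; apply/setP=> W.
  by rewrite !inE /pluecker_functional sum_delta.
have lt12 : ((val ij).1 < (val ij).2)%N := valP ij.
have i1 : e`_(val ij).1 \in flag e ab.1 by rewrite mem_flag // E1.
have i2 : e`_(val ij).2 \in flag e ab.2 by rewrite mem_flag // E2.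
have BE x y : x \in flag e ab.1 ->
    pluecker_form e w x y = coord e (val ij).1 x * coord e (val ij).2 y.
  move=> xA; rewrite pluecker_form_delta /minor.
  rewrite [coord e (val ij).2 x](coord_flag e_free _ xA) ?mul0r ?subr0 //.
  by rewrite -E1.
have cE x : x \in flag e ab.1 ->
    pluecker_form e w x e`_(val ij).2 = coord e (val ij).1 x.
  by move=> xA; rewrite BE // coord_free // eqxx mulr1.
rewrite (card_planes_isotropic (pluecker_form_alt e w) (pluecker_form_anti e w)
   (flagS e (ltnW ltab)) _ i1 i2) ?dim_flag ?(leq_trans (ltnW ltab)) //.
- move=> x y xA yA; rewrite /= BE // (coord_flag e_free _ yA) ?mulr0 //.
  by rewrite -E1.
- by rewrite /= cE // coord_free // eqxx oner_eq0.
- by move=> x y xA yA'; rewrite /= cE // BE // => ->; rewrite mul0r.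
Qed.

(** Pluecker coordinates are indexed from 0, so the strict inequalities say that
    the pair counted from 1 is at most (a, b) in both components. *)
Lemma schubert_cycle_corner (ij : pluecker_index m) ab W :
  schubert_index m ab -> W \in schubert_cycle e ab -> pluecker e W ij != 0 ->
  ((val ij).1 < ab.1)%N && ((val ij).2 < ab.2)%N.
Proof.
case/and3P=> _ ltab _ Wab Wij.
pose w (kl : pluecker_index m) : F := (kl == ij)%:R.
have : W \in [set W in schubert_cycle e ab | pluecker_functional e w W != 0].
  rewrite !inE /pluecker_functional sum_delta Wij andbT.
  by move: Wab; rewrite !inE.
rewrite schubert_cycle_planes.
case/(planes_witness (pluecker_form_alt e w) (pluecker_form_anti e w)
        (flagS e (ltnW ltab)))=> x [y [xA yA']].
rewrite /= pluecker_form_delta; exact: minor_flag.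
Qed.

End SchubertCount.

(** A cycle contained in another one could be left out of the union. *)
Lemma proper_schubert_union_antichain (F : finFieldType) (V : vectType F)
    (m : nat) (e : m.-tuple V) s (ab : 'I_s -> nat * nat)
    (SU : {set {vspace V}}) i j :
  is_proper_schubert_union e ab SU ->
  ((ab i).1 <= (ab j).1)%N -> ((ab i).2 <= (ab j).2)%N -> i = j.
Proof.
case: s => [|s] in ab i j *; first by case: i.
case=> -[ab_ok ->] not_fewer le1 le2; apply/eqP/contraT => neq_ij.
case: not_fewer; exists (fun k => ab (lift i k)); split.
  by move=> k; apply: ab_ok.
apply/setP=> W; apply/bigcupP/bigcupP => -[k _ Wk]; last by exists (lift i k).
case: (unliftP i k) Wk => [l -> | ->] Wk; first by exists l.
case: (unliftP i j) le1 le2 neq_ij => [l -> | ->]; last by rewrite eqxx.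
move=> le1 le2 _; exists l => //.
exact: (subsetP (schubert_cycleS e le1 le2)) Wk.
Qed.

(** * Weights of code words *)

Section Code.

Local Open Scope ring_scope.

Variables (F : finFieldType) (V : vectType F) (m : nat) (e : m.-tuple V).
Variables (SU : {set {vspace V}}) (G : 'M[F]_(cone_span_dim e SU, #|SU|)).
Variables (row : 'I_(cone_span_dim e SU) -> pluecker_index m).
Variables (pt : 'I_#|SU| -> {vspace V}) (c : 'I_#|SU| -> F).
Hypothesis pt_inj : injective pt.
Hypothesis pt_onto : forall W, W \in SU <-> exists j, pt j = W.
Hypothesis c_neq0 : forall j, c j != 0.
Hypothesis G_def : forall i j, G i j = c j * pluecker e (pt j) (row i).

Lemma card_points (P : pred {vspace V}) :
  #|[set j | P (pt j)]| = #|[set W in SU | P W]|.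
Proof.
rewrite -(card_imset _ pt_inj); apply: eq_card => W; rewrite inE.
apply/imsetP/andP => [[j] | [/pt_onto[j <-] Pj]].
  by rewrite inE => Pj ->; split=> //; apply/pt_onto; exists j.
by exists j; rewrite ?inE.
Qed.

(** Summing over the rows that carry a given coordinate gives the value 0 at the
    deleted coordinates. *)
Definition word_coef (u : 'rV[F]_(cone_span_dim e SU)) ij : F :=
  \sum_(i | row i == ij) u 0 i.

Lemma word_coord u j :
  (u *m G) 0 j = c j * pluecker_functional e (word_coef u) (pt j).
Proof.
rewrite mxE (partition_big row xpredT) //= mulr_sumr; apply: eq_bigr => ij _.
rewrite /word_coef mulr_suml mulr_sumr; apply: eq_bigr => i /eqP <-.
by rewrite G_def mulrCA.
Qed.

Lemma hamming_dist_points u :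
  #|[set j | (u *m G) 0 j != 0]| =
  #|[set W in SU | pluecker_functional e (word_coef u) W != 0]|.
Proof.
rewrite -card_points; apply: eq_card => j.
by rewrite !inE word_coord mulf_eq0 negb_or c_neq0.
Qed.

End Code.

Theorem proposition8p1 (F : finFieldType) (V : vectType F) (m : nat)
    (e : m.-tuple V) (he : basis_of fullv e)
    (s : nat) (hs : 1 <= s) (ab : 'I_s -> nat * nat) (SU : {set {vspace V}})
    (hSU : is_proper_schubert_union e ab SU)
    (delta : nat) (hdelta : exists i, delta = krull_dim (ab i))
    (hdelta_min : forall i, delta <= krull_dim (ab i))
    (G : 'M[F]_(cone_span_dim e SU, #|SU|)) (hG : is_generator_matrix G) :
  is_min_distance (linear_code G) (#|F| ^ delta).
Proof.
have e_free := basis_free he.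
have [[ab_ok SU_def] _] := hSU.
have mem_SU W : reflect (exists i, W \in schubert_cycle e (ab i)) (W \in SU).
  by rewrite SU_def; apply: (iffP bigcupP) => -[i] *; exists i.
have [row [pt [c [[row_inj row_onto] [pt_inj pt_onto] c_neq0 G_def]]]] := hG.
split; last first.
  move=> x y; rewrite !inE => xC yC neq_xy.
  have : ((x - y)%R <= G)%MS by rewrite addmx_sub ?eqmx_opp.
  case/submxP=> u xyE.
  have -> : hamming_dist x y = #|[set j | ((u *m G) 0 j != 0)%R]|.
    by apply: eq_card => j; rewrite !inE -xyE !mxE subr_eq0.
  rewrite (hamming_dist_points pt_inj pt_onto c_neq0 G_def).
  have [W WSU wW] : exists2 W, W \in SU &
      (pluecker_functional e (word_coef row u) W != 0)%R.
    have /rV0Pn[j] : (x - y != 0)%R by rewrite subr_eq0.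
    rewrite xyE (word_coord G_def) mulf_eq0 negb_or => /andP[_ wj].
    by exists (pt j) => //; apply/pt_onto; exists j.
  have [i Wi] := mem_SU _ WSU.
  apply: leq_trans (leq_trans
    (schubert_cycle_count_ge e_free (ab_ok i) Wi wW) _).
    by rewrite leq_exp2l // card_finNzRing_gt1.
  apply/subset_leq_card/subsetP=> W'; rewrite !inE => /andP[W'i ->].
  by rewrite andbT; apply/mem_SU; exists i; rewrite !inE.
have [i0 ->] := hdelta.
have /and3P[a1 ltab bm] := ab_ok i0.
have im : ((ab i0).1.-1 < m)%N by lia.
have jm : ((ab i0).2.-1 < m)%N by lia.
have ltij : (Ordinal im < Ordinal jm)%N by rewrite /=; lia.
pose ij : pluecker_index m := Sub (Ordinal im, Ordinal jm) ltij.
have ij1 : (val ij).1.+1 = (ab i0).1 by rewrite SubK /=; lia.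
have ij2 : (val ij).2.+1 = (ab i0).2 by rewrite SubK /=; lia.
have countSU : #|[set W in SU | (pluecker e W ij != 0)%R]| =
    (#|F| ^ krull_dim (ab i0))%N.
  rewrite -(schubert_cycle_corner_count e_free (ab_ok i0) ij1 ij2).
  apply: eq_card => W; rewrite !inE; apply/andP/andP => -[W1 Wij]; split=> //.
    have [i Wi] := mem_SU _ W1.
    have := schubert_cycle_corner e_free (ab_ok i) Wi Wij.
    rewrite ij1 ij2 => /andP[le1 le2].
    by move: Wi; rewrite -(proper_schubert_union_antichain hSU le1 le2) !inE.
  by apply/mem_SU; exists i0; rewrite !inE.
have [k row_k] : exists k, row k = ij.
  apply/row_onto; rewrite inE; apply/existsP.
  have /card_gt0P[W] : (0 < #|[set W in SU | (pluecker e W ij != 0)%R]|)%N.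
    by rewrite countSU expn_gt0 (ltnW (card_finNzRing_gt1 F)).
  by rewrite inE; exists W.
have dist_k : hamming_dist (matrix.row k G) 0%R = (#|F| ^ krull_dim (ab i0))%N.
  rewrite -countSU -(card_points pt_inj pt_onto); apply: eq_card => j.
  by rewrite !inE !mxE G_def mulf_eq0 negb_or c_neq0 row_k.
exists (matrix.row k G), 0%R; split; rewrite ?inE ?row_sub ?sub0mx //.
apply/eqP=> row0; move: dist_k; rewrite row0.
rewrite /hamming_dist (_ : [set _ | _] = set0) ?cards0; last first.
  by apply/setP=> j; rewrite !inE eqxx.
by move/esym/eqP; rewrite expn_eq0 -leqn0 leqNgt (ltnW (card_finNzRing_gt1 F)).
Qed.
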